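(* Let $d\ge 3$ and let $F\le\mathrm{Sym}(\{1,\dots,d\})$ be primitive but not $2$-transitive and not cyclic of prime order. Let $(\pi,\mathcal{H})$ be a unitary representation of $U(F)^+$ without non-zero $U(F)^+$-invariant vectors, where $\mathcal{H}$ is a separable complex Hilbert space. Let $v\in\mathcal{H}$, $v\neq 0$, be such that $(U(F)^+)_v:=\{g\in U(F)^+\mid \pi(g)(v)=v\}$ is not compact. Then $(U(F)^+)_v=(U(F)^+)_\eta^0$ for some end $\eta\in\partial T_d$.
   Context: $T_d$ is the $d$-regular tree, $d\ge 3$, $\partial T_d$ its set of ends, and $\mathrm{Aut}(T_d)$ is its automorphism group with the compact-open topology. A legal coloring of $T_d$ is a map $\iota$ from the set of unoriented edges of $T_d$ to $\{1,\dots,d\}$ whose restriction to the star $E(x)$ (the set of edges containing $x$) is a bijection onto $\{1,\dots,d\}$ for every vertex $x$. Fix such an $\iota$. For $F\le \mathrm{Sym}(\{1,\dots,d\})$, $U(F):=\{g\in \mathrm{Aut}(T_d) \mid \iota\circ g\circ(\iota|_{E(x)})^{-1}\in F \text{ for every vertex } x\}$, and $U(F)^+$ is the subgroup of $U(F)$ generated by those elements of $U(F)$ which fix some edge of $T_d$ pointwise; it is a closed subgroup of $\mathrm{Aut}(T_d)$. ''Primitive'' and ''$2$-transitive'' refer to the action of $F$ on $\{1,\dots,d\}$. A unitary representation is a strongly continuous homomorphism into the unitary group of an (infinite-dimensional) complex Hilbert space. For $\eta\in\partial T_d$, $(U(F)^+)_\eta^0:=\{g\in U(F)^+\mid g(\eta)=\eta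 \text{ and } g \text{ fixes a vertex of } T_d\}$. *)

(* Defs.v *)
From HB Require Import structures.
From mathcomp Require Import all_boot all_order all_algebra all_fingroup all_solvable.
From mathcomp Require Import all_classical all_reals all_analysis.
From mathcomp Require Import complex.
Set Implicit Arguments.
Unset Strict Implicit.
Unset Printing Implicit Defensive.
Import Order.TTheory GRing.Theory Num.Theory.
Import numFieldNormedType.Exports.

Local Open Scope classical_set_scope.
Local Open Scope card_scope.
Local Open Scope ring_scope.

Section Tree.
Variables (V : discreteTopologicalType) (adj : rel V) (d : nat).

(* A simple cycle [:: x_1; ...; x_n] of size n <= 2 is degenerate: a loop for
   n = 1 (excluded by irreflexivity), one edge run through twice for n = 2. *)
Record regular_tree : Prop := RegularTree {
  tree_nonempty : inhabited V ;
  tree_irrefl : irreflexive adj ;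
  tree_sym : symmetric adj ;
  tree_connected : forall x y, exists p, path adj x p /\ last x p = y ;
  tree_acyclic : forall c : seq V, path.cycle adj c -> uniq c -> (size c <= 2)%N ;
  tree_regular : forall x, [set y | adj x y] #= `I_d }.

Definition edges : set (set V) :=
  [set E | exists x y, adj x y /\ E = [set x; y]].

Definition star (x : V) : set (set V) := [set E | edges E /\ E x].

(* The values of i outside [edges] are irrelevant. *)
Definition legal_coloring (i : set V -> 'I_d) : Prop :=
  forall x, set_bij (star x) [set: 'I_d] i.

(* Automorphisms are maps on vertices; composition is \o. *)
Definition Aut_tree : set (V -> V) :=
  [set g : V -> V | bijective g /\ forall x y, adj (g x) (g y) = adj x y].

Definition subgroup_Aut (A : set (V -> V)) : Prop :=
  [/\ A `<=` Aut_tree, A id,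
      forall g h, A g -> A h -> A (g \o h) &
      forall g h, A g -> cancel g h -> cancel h g -> A h].

Definition universal_group (i : set V -> 'I_d) (F : {group {perm 'I_d}}) :
    set (V -> V) :=
  [set g : V -> V | Aut_tree g /\
     forall x, exists2 s : {perm 'I_d}, s \in F &
       forall E, star x E -> i (g @` E) = s (i E)].

Definition universal_group_plus (i : set V -> 'I_d)
    (F : {group {perm 'I_d}}) : set (V -> V) :=
  smallest subgroup_Aut
    [set g : V -> V | universal_group i F g /\
       exists2 E, edges E & forall x, E x -> g x = x].

Definition ray (r : nat -> V) : Prop :=
  injective r /\ forall n, adj (r n) (r n.+1).

Definition cofinal (r s : nat -> V) : Prop :=
  exists m n, forall k, r (m + k)%N = s (n + k)%N.

Definition ends : set (set (nat -> V)) :=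
  [set eta : set (nat -> V) | exists2 r, ray r & eta = [set s : nat -> V | ray s /\ cofinal r s]].

Definition act_end (g : V -> V) (eta : set (nat -> V)) : set (nat -> V) :=
  (fun r => g \o r) @` eta.

Definition end_stab0 (G : set (V -> V)) (eta : set (nat -> V)) :
    set (V -> V) :=
  [set g : V -> V | [/\ G g, act_end g eta = eta & exists x, g x = x]].

End Tree.

Section Representation.
Variables (R : realType) (H : completeNormedModType R[i]).

(* The form [ip] is linear in its first argument. *)
Definition hilbert_product (ip : {dot H for @Num.conj R[i]}) : Prop :=
  forall u, `|u| ^+ 2 = ip u u.

Definition separable_space (T : topologicalType) : Prop :=
  exists2 D : set T, countable D & dense D.

Definition finite_dimensional : Prop :=
  exists n (b : 'I_n -> H), forall w, exists c : 'I_n -> R[i],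
    w = \sum_(k < n) c k *: b k.

Variable V : discreteTopologicalType.

(* For discrete V the compact-open topology on V -> V is that of pointwise
   convergence.  Only the values of [pi] on the group G matter. *)
Record unitary_rep (ip : {dot H for @Num.conj R[i]}) (G : set (V -> V))
    (pi : (V -> V) -> {linear H -> H}) : Prop := UnitaryRep {
  rep_surj : forall g, G g -> forall w, exists u, pi g u = w ;
  rep_ip : forall g, G g -> forall u w, ip (pi g u) (pi g w) = ip u w ;
  rep_mul : forall g h, G g -> G h -> forall u, pi (g \o h) u = pi g (pi h u) ;
  rep_cont : forall u,
    {within (G : set {compact-open, V -> V}), continuous (fun g => pi g u)} }.

Definition vector_stab (G : set (V -> V)) (pi : (V -> V) -> {linear H -> H})
    (v : H) : set (V -> V) :=
  [set g : V -> V | G g /\ pi g v = v].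

End Representation.

(* Main.v *)
Require Import Defs.
From HB Require Import structures.
From mathcomp Require Import all_boot all_order all_algebra all_fingroup all_solvable.
From mathcomp Require Import all_classical all_reals all_analysis.
From mathcomp Require Import complex zify.
Import Order.TTheory GRing.Theory Num.Theory.
Import numFieldNormedType.Exports.
Local Open Scope classical_set_scope.
Local Open Scope ring_scope.
Set Implicit Arguments.
Unset Strict Implicit.
Unset Printing Implicit Defensive.

(** Write [G] for [U(F)+] and [K] for the stabilizer of [v] in [G]. If [u] is in
    [G] and there are [g_n], [h_n] in [K] such that [h_n u g_n] tends to the
    identity, then [pi u v = v], because [pi] is isometric and continuous
    ([vector_stab_limit]). This closure property of [K] is the only trace that
    the representation leaves; the rest is geometry of the tree.

    Suppose that some [w] in [K] fixes no vertex. Elements of [G] displace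
    vertices by even distances, so [w] translates a ray ([hyperbolic_axis]), and
    conjugation by powers of [w] contracts to the identity every [u] that is
    trivial on one of the half-trees of an edge of this ray. By Tits'
    independence property ([half_map_universal]) the elements of [U(F)] fixing
    an edge are products of two such elements, so [K] contains the edge
    stabilizers of two consecutive edges ([axis_edge_sub]). Two distinct point
    stabilizers of the primitive group [F] generate [F]
    ([primitive_stab_generate]), so [K] contains the vertex stabilizer of the
    common vertex, then those of all vertices ([full_neighbour]), and [K = G].
    Then [v] is invariant, a contradiction.

    Hence every element of [K] fixes a vertex. Any two elements of [K] then have
    a common fixed vertex ([fixed_meet]), and the projections of a base point to
    the fixed trees form a chain ([elliptic_group]). If the chain is bounded,
    [K] fixes a vertex, and it is compact ([vertex_fixing_compact]). Otherwise
    the chain spans a ray with end [eta] that is eventually fixed by every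
    element of [K], and elements of [K] that fix it only very far out conjugate
    the fixators of half-trees containing [eta] towards the identity, so [K]
    contains these fixators ([half_tree_fixer_sub]). An element [f] of [G] that
    fixes [eta] and a vertex is in [K] as well: it fixes the ray from some
    vertex on, and by independence it is the limit of the maps that agree with
    [f] behind the [n]-th edge of the ray and are trivial beyond it, which
    belong to these fixators ([mautner_subgroup]). *)

(** * Distance and geodesics in a tree *)

(** The path metric of a graph. It is [0] between vertices that are joined by
    no path, which does not happen in a tree. *)
Definition dist (V : choiceType) (adj : rel V) (x y : V) : nat :=
  xget 0%N [set n | (exists2 p, path adj x p & last x p = y /\ size p = n) /\
    forall p, path adj x p -> last x p = y -> (n <= size p)%N].

Section TreeGeometry.
Variables (V : discreteTopologicalType) (adj : rel V) (d : nat).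
Hypothesis tr : regular_tree adj d.

Local Notation D := (dist adj).

Lemma dist_spec x y :
  (exists2 p, path adj x p & last x p = y /\ size p = D x y) /\
  forall p, path adj x p -> last x p = y -> (D x y <= size p)%N.
Proof.
pose P n := `[< exists2 p, path adj x p & last x p = y /\ size p = n >].
have exP : exists n, P n.
  have [p [pp lp]] := tree_connected tr x y.
  by exists (size p); apply/asboolP; exists p.
rewrite /dist; case: xgetP => [n _ //|]; case: (ex_minnP exP) => n /asboolP pn mn.
case/(_ n); split=> // p pp lp; apply: mn; apply/asboolP; by exists p.
Qed.

Lemma dist_le x p : path adj x p -> (D x (last x p) <= size p)%N.
Proof. by move=> pp; apply: (dist_spec x (last x p)).2. Qed.

Lemma dist_refl x : D x x = 0%N.
Proof. by apply/eqP; rewrite -leqn0; exact: (@dist_le x [::]). Qed.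

Lemma dist_eq0 x y : D x y = 0%N -> x = y.
Proof. by have [[[|a p] pp [<- sp]] _] := dist_spec x y; rewrite -sp. Qed.

Lemma dist_sym x y : D x y = D y x.
Proof.
suff le a b : (D a b <= D b a)%N by apply/eqP; rewrite eqn_leq !le.
have [[p pp [<- <-]] _] := dist_spec b a.
have := rev_path adj b p; rewrite (eq_path (e' := adj)); last first.
  by move=> u w /=; rewrite (tree_sym tr).
rewrite pp => pr; have := dist_le pr; rewrite size_rev size_belast.
by case: p {pp pr} => [|c p] //=; rewrite rev_cons last_rcons.
Qed.

Lemma dist_triangle x y z : (D x z <= D x y + D y z)%N.
Proof.
have [[p pp [lp <-]] _] := dist_spec x y.
have [[q pq [lq <-]] _] := dist_spec y z.
rewrite -size_cat -lq -[in last y q]lp -last_cat; apply: dist_le.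
by rewrite cat_path pp lp.
Qed.

Lemma adj_neq x y : adj x y -> x != y.
Proof. by apply: contraTneq => ->; rewrite (tree_irrefl tr). Qed.

Lemma adj_sym x y : adj x y -> adj y x.
Proof. by rewrite (tree_sym tr). Qed.

Lemma dist_adj x y : adj x y -> D x y = 1%N.
Proof.
move=> a; apply/eqP; rewrite eqn_leq lt0n; apply/andP; split.
  by apply: (@dist_le x [:: y]); rewrite /= a.
by apply/eqP => /dist_eq0 e; move/eqP: (adj_neq a).
Qed.

Lemma closer_exists x y : x != y -> exists2 z, adj x z & D x y = (D z y).+1.
Proof.
have [[[|z p] /= pp [lp sp]] _] := dist_spec x y; first by rewrite lp eqxx.
case/andP: pp => az pp _; exists z => //.
have := dist_triangle x z y; rewrite (dist_adj az) add1n -sp => le.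
by have := dist_le pp; rewrite lp; lia.
Qed.

(** A neighbour of [x] that is not farther from [y] than [x] stays connected to
    [y] when [x] is deleted. *)
Lemma path_avoiding x y z : adj x z -> (D z y <= D x y)%N ->
  exists p, [/\ path adj z p, last z p = y & x \notin z :: p].
Proof.
move=> az le.
have [[p pp [lp sp]] _] := dist_spec z y.
exists p; split=> //; rewrite inE negb_or adj_neq //=.
apply/negP => xp; move: pp lp sp; case/splitPr: xp => p1 p2.
rewrite cat_path last_cat size_cat /= => /andP[_ /andP[_ p2p]] lp sp.
have := dist_le p2p; rewrite lp; lia.
Qed.

(** A vertex [x] has at most one neighbour that is not farther from [y]: two of
    them would be joined by a path avoiding [x], hence lie on a cycle. *)
Lemma closer_unique x y z1 z2 : adj x z1 -> adj x z2 ->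
  (D z1 y <= D x y)%N -> (D z2 y <= D x y)%N -> z1 = z2.
Proof.
move=> a1 a2 le1 le2; apply/eqP/negPn/negP => neq.
have [p [pp lp xp]] := path_avoiding a1 le1.
have [q [pq lq xq]] := path_avoiding a2 le2.
have [r [pr lr xr]] : exists r, [/\ path adj z1 r, last z1 r = z2 & x \notin r].
  have pr := rev_path adj z2 q.
  rewrite (eq_path (e' := adj)) ?pq in pr; last first.
    by move=> u w /=; rewrite (tree_sym tr).
  exists (p ++ rev (belast z2 q)); rewrite cat_path last_cat lp -{1}lq pp pr.
  split=> //; last first.
    rewrite mem_cat mem_rev negb_or; move: xp; rewrite inE negb_or => /andP[_ ->] /=.
    by apply: contra xq; exact: mem_belast.
  by case: q lq {pq xq pr} => [//|c q] /= _; rewrite rev_cons last_rcons.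
case/shortenP: pr lr => s ps us sub ls.
have xs : x \notin z1 :: s.
  by rewrite inE negb_or adj_neq //=; apply: contra xr; exact: sub.
have := @tree_acyclic _ _ _ tr (x :: z1 :: s); rewrite /= a1 -cats1 cat_path ps /= ls.
rewrite adj_sym // xs => /(_ isT us).
by case: s ls {ps us sub xs} => //= e; move: neq; rewrite e eqxx.
Qed.

(** A tree is bipartite. *)
Lemma dist_step z x y : adj x y -> D z y = (D z x).+1 \/ D z x = (D z y).+1.
Proof.
move=> a; have l1 := dist_triangle z x y; have l2 := dist_triangle z y x.
rewrite (dist_adj a) (dist_adj (adj_sym a)) in l1 l2.
suff : D z x <> D z y by lia.
move=> e; have [exz|nxz] := eqVneq x z.
  move: a; rewrite exz in e *; rewrite dist_refl in e.
  by rewrite (dist_eq0 (esym e)) (tree_irrefl tr).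
have [w aw ew] := closer_exists nxz.
rewrite -!(dist_sym z) in ew.
suff ywE : y = w by move: ew; rewrite -ywE e; lia.
by apply: (@closer_unique x z) => //; rewrite -!(dist_sym z); lia.
Qed.

(** Seen from [z], going one step back decreases the distance and every other
    step increases it. *)
Lemma dist_forward z x y y' : adj x y -> D z x = (D z y).+1 ->
  adj x y' -> y' != y -> D z y' = (D z x).+1.
Proof.
move=> a e a' ne; have [//|e'] := dist_step z a'.
case/eqP: ne; apply: (@closer_unique x z) => //; rewrite -!(dist_sym z); lia.
Qed.

(** The edge [y y'] separates [x] from [z], hence lies on the geodesic from
    [x] to [z]. *)
Lemma geod_cat x y y' z : adj y y' -> (D y' z < D y z)%N -> (D x y < D x y')%N ->
  D x z = (D x y + D y z)%N.
Proof.
have [n] := ubnP (D y z); elim: n y y' => // n IH y y' len a l1 l2.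
have e1 : D y z = (D y' z).+1.
  by have := dist_step z a; rewrite ![D z _]dist_sym; lia.
have e2 : D x y' = (D x y).+1 by have := dist_step x a; lia.
have [y'z|ny'z] := eqVneq y' z.
  by rewrite -y'z e2 (dist_adj a); lia.
have [y'' a'' e''] := closer_exists ny'z.
have ne : y'' != y by apply/eqP => e; move: e''; rewrite e; lia.
have := dist_forward (adj_sym a) e2 a'' ne => e3.
by rewrite (IH y' y'') //; lia.
Qed.

(** Two points at the same distance from [x] on geodesics from [x] to [y]
    coincide. *)
Lemma geod_unique x y a b : D x y = (D x a + D a y)%N ->
  D x y = (D x b + D b y)%N -> D x a = D x b -> a = b.
Proof.
have [n] := ubnP (D a y); elim: n y => // n IH y len ea eb eab.
have [ay|nay] := eqVneq y a.
  rewrite ay dist_refl in ea eb; rewrite -ay in ea eb *.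
  by apply/esym/dist_eq0; rewrite ay in eab eb *; lia.
have nby : y != b.
  apply/eqP => yb; rewrite -yb dist_refl in eb; case/eqP: nay.
  by apply/esym/dist_eq0; rewrite -yb in eab; lia.
have [q aq eq] := closer_exists nay; have [r ar er] := closer_exists nby.
have t1 := dist_triangle x a q; have t2 := dist_triangle x b r.
rewrite [D a q]dist_sym in t1; rewrite [D b r]dist_sym in t2.
rewrite [D a y]dist_sym in ea len; rewrite [D b y]dist_sym in eb.
have qr : q = r.
  by apply: (@closer_unique y x) => //; rewrite -!(dist_sym x); lia.
have sq := dist_step x aq.
by rewrite -qr in er t2; apply: (IH q) => //; rewrite ?[D a q]dist_sym ?[D b q]dist_sym; lia.
Qed.

(** Geodesics contain points at every intermediate distance. *)
Lemma geod_point x y n : (n <= D x y)%N ->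
  exists2 z, D x z = n & D x y = (n + D z y)%N.
Proof.
move: {2}(D x y - n)%N (erefl (D x y - n)%N) => m.
elim: m y => [|m IH] y e le; first by exists y; rewrite ?dist_refl; lia.
have nyx : y != x by apply/eqP => yx; rewrite yx dist_refl in e le; lia.
have [q aq eq] := closer_exists nyx; rewrite -!(dist_sym x) in eq.
have [||z e1 e2] := IH q; [lia|lia|exists z => //].
have := dist_triangle x z y; have := dist_triangle z q y.
rewrite (dist_adj (adj_sym aq)); lia.
Qed.

Lemma dist_parity x y z : odd (D x z) = odd (D x y) (+) odd (D y z).
Proof.
have [[p pp [<- <-]] _] := dist_spec y z.
elim/last_ind: p pp => [|p a IH] /=; first by rewrite addbF.
rewrite rcons_path last_rcons size_rcons => /andP[/IH IHp aa] /=.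
have : odd (D x a) = ~~ odd (D x (last y p)).
  by case: (dist_step x aa) => -> /=; rewrite ?negbK.
by move->; rewrite IHp addbN.
Qed.

(** * Rays *)

(** Infinite paths without backtracking; they are geodesic by [nbray_dist]. *)
Definition nbray (a : nat -> V) :=
  forall n, adj (a n) (a n.+1) /\ a n.+2 != a n.

Lemma nbray_shift a k : nbray a -> nbray (fun n => a (k + n)%N).
Proof. by move=> na n; rewrite !addnS; exact: na. Qed.

(** Once a ray moves away from [z], it does so for ever. *)
Lemma nbray_up a z k : nbray a -> (D z (a k) < D z (a k.+1))%N ->
  forall n, D z (a (k + n)%N) = (D z (a k) + n)%N.
Proof.
move=> na lt.
suff step n : D z (a (k + n)%N) = (D z (a k) + n)%N /\ D z (a (k + n).+1) = (D z (a k) + n).+1.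
  by move=> n; case: (step n).
elim: n => [|n [IH1 IH2]].
  by rewrite addn0; split; [lia|have := dist_step z (na k).1; lia].
rewrite addnS; split; first by rewrite IH2 addnS.
have [ad ne] := na (k + n)%N.
by rewrite (dist_forward (adj_sym ad) _ (na (k + n).+1).1 ne) IH2 ?IH1 ?addnS.
Qed.

Lemma nbray_up_lt a z k n : nbray a -> (D z (a k) < D z (a k.+1))%N -> (k <= n)%N ->
  (D z (a n) < D z (a n.+1))%N.
Proof.
move=> na lt kn; have := nbray_up na lt (n - k); have := nbray_up na lt (n.+1 - k).
rewrite !subnKC; lia.
Qed.

Lemma nbray_dist a k n : nbray a -> D (a k) (a (k + n)%N) = n.
Proof.
move=> na; rewrite (nbray_up na) ?dist_refl // (dist_adj (na k).1) //.
Qed.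

Lemma nbray_ray a : nbray a -> ray adj a.
Proof.
move=> na; split; last by move=> n; exact: (na n).1.
suff H i j : (i <= j)%N -> a i = a j -> i = j.
  by move=> i j e; case: (leqP i j) => h; [exact: H|apply/esym/H => //; lia].
move=> ij e; have := nbray_dist i (j - i) na; rewrite subnKC // -e dist_refl; lia.
Qed.

(** Vertices within distance [n] of the origin of a ray see the edges of the
    ray after its [n]-th vertex as outgoing. *)
Lemma nbray_far a z n : nbray a -> (D (a 0%N) z <= n)%N ->
  (D z (a n) < D z (a n.+1))%N.
Proof.
move=> na le; case: (dist_step z (na n).1) => [->//|e].
have down k : (k <= n)%N -> (D z (a k) = D z (a n.+1) + (n.+1 - k))%N.
  move=> kn; case: (leqP (D z (a k.+1)) (D z (a k))) => h; last first.
    by have := nbray_up_lt na h kn; lia.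
  move: kn h; move: {2}(n - k)%N (erefl (n - k)%N) => m.
  elim: m k => [|m IH] k em kn h; first by have -> : k = n; lia.
  have := dist_step z (na k).1 => st.
  case: (leqP (D z (a k.+2)) (D z (a k.+1))) => h'.
    by have := IH k.+1; lia.
  by have : (k.+1 <= n)%N -> _ := nbray_up_lt na h'; move: st e; have [->|] := eqVneq k n; lia.
have := down 0%N isT; rewrite [D z (a 0%N)]dist_sym; lia.
Qed.

Lemma nbray_eventually_up a z : nbray a ->
  exists k, (D z (a k) < D z (a k.+1))%N.
Proof. by move=> na; exists (D (a 0%N) z); exact: nbray_far. Qed.

End TreeGeometry.

(** * Groups of tree automorphisms *)

Section TreeAutomorphisms.
Variables (V : discreteTopologicalType) (adj : rel V) (d : nat).
Hypothesis tr : regular_tree adj d.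

Local Notation D := (dist adj).

Lemma aut_inj (g : V -> V) : Aut_tree adj g -> injective g.
Proof. by case=> /bij_inj. Qed.

Lemma aut_inverse (g : V -> V) : Aut_tree adj g ->
  exists2 h, Aut_tree adj h & cancel g h /\ cancel h g.
Proof.
case=> -[h gK hK] ga; exists h => //; split; first by exists g.
by move=> x y; rewrite -ga !hK.
Qed.

Lemma aut_dist (g : V -> V) x y : Aut_tree adj g -> D (g x) (g y) = D x y.
Proof.
have le (f : V -> V) u w : Aut_tree adj f -> (D (f u) (f w) <= D u w)%N.
  move=> [_ fa]; have [[p pp [<- <-]] _] := dist_spec tr u w.
  rewrite -last_map -(size_map f); apply: (dist_le tr).
  by rewrite path_map (eq_path (e' := adj)).
move=> ga; have [h ha [gK hK]] := aut_inverse ga.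
by apply/eqP; rewrite eqn_leq le //= -{1}(gK x) -{1}(gK y) le.
Qed.

(** The set of fixed vertices is convex. *)
Lemma fixed_convex (g : V -> V) x y q : Aut_tree adj g -> g x = x -> g y = y ->
  D x y = (D x q + D q y)%N -> g q = q.
Proof.
move=> ga gx gy e; apply: (@geod_unique _ _ _ tr x y) => //.
  by rewrite -{2}gx -{2}gy !aut_dist.
by rewrite -{1}gx !aut_dist.
Qed.

(** [p] is the vertex fixed by [g] that is closest to [x]. *)
Definition fixed_proj (g : V -> V) (x p : V) :=
  g p = p /\ forall q, g q = q -> (D x p <= D x q)%N.

Lemma fixed_proj_exists (g : V -> V) x : (exists y, g y = y) ->
  exists p, fixed_proj g x p.
Proof.
move=> [y gy].
have exP : exists n, `[< exists2 p, g p = p & D x p = n >].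
  by exists (D x y); apply/asboolP; exists y.
case: (ex_minnP exP) => n /asboolP[p gp <-] min; exists p; split=> // q gq.
by apply: min; apply/asboolP; exists q.
Qed.

(** The geodesic from [b] to [g b] passes through the projection of [b] to the
    fixed tree, at its midpoint. *)
Lemma fixed_proj_displacement (g : V -> V) b a : Aut_tree adj g ->
  fixed_proj g b a -> D b (g b) = (D b a + D b a)%N.
Proof.
move=> ga [gfa min]; have [eab|nab] := eqVneq a b.
  by rewrite -eab gfa (dist_refl tr).
have [a' aa' e] := closer_exists tr nab; rewrite -!(dist_sym tr b) in e.
have gba : D (g b) a = D b a by rewrite -{1}gfa aut_dist.
have ne : a' != g a'.
  by apply/eqP => /esym /min; rewrite e ltnn.
have f1 : D (g b) a = (D (g b) (g a')).+1 by rewrite gba aut_dist // e.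
have ag : adj a (g a') by rewrite -{1}gfa ga.2.
have f2 := dist_forward tr ag f1 aa' ne.
rewrite (dist_sym tr b (g b)) (@geod_cat _ _ _ tr (g b) a a' b) // ?f2 //.
  by rewrite gba (dist_sym tr a b).
by rewrite -!(dist_sym tr b) e.
Qed.

Lemma fixed_proj_geod (g : V -> V) x p z : Aut_tree adj g -> fixed_proj g x p -> g z = z ->
  D x z = (D x p + D p z)%N.
Proof.
move=> ga [gp min] gz; have [<-|npz] := eqVneq p z; first by rewrite (dist_refl tr) addn0.
have [y ay e] := closer_exists tr npz.
apply: (geod_cat tr ay); first by rewrite e.
have gy : g y = y.
  apply: (fixed_convex ga gp gz); rewrite e (dist_adj tr ay); lia.
by have := min _ gy; have := dist_step tr x ay; lia.
Qed.

(** Two automorphisms have a common fixed vertex as soon as they and their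
    product have fixed vertices. If [b] is fixed by [h], then [b] is displaced equally by [g] and by
    [g \o h]; both displacements have the same midpoint, which is the
    projection of [b] to either fixed set. *)
Lemma fixed_meet (g h : V -> V) : Aut_tree adj g -> Aut_tree adj h ->
  (exists x, g x = x) -> (exists x, h x = x) -> (exists x, (g \o h) x = x) ->
  exists x, g x = x /\ h x = x.
Proof.
move=> ga ha fg [b hb] ff.
have fa : Aut_tree adj (g \o h).
  split; first exact: bij_comp ga.1 ha.1.
  by move=> x y /=; rewrite ga.2 ha.2.
have [a pa] := fixed_proj_exists b fg; have [c pc] := fixed_proj_exists b ff.
have ea := fixed_proj_displacement ga pa.
have ec := fixed_proj_displacement fa pc.
rewrite /= hb in ec.
have da : D a (g b) = D b a by rewrite -{1}pa.1 aut_dist // (dist_sym tr).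
have dc : D c (g b) = D b c.
  by rewrite -[in LHS]pc.1 /= (aut_dist _ _ ga) -{1}hb (aut_dist _ _ ha) (dist_sym tr c).
have eac : a = c by apply: (@geod_unique _ _ _ tr b (g b)); lia.
exists a; split; first exact: pa.1.
by have := pc.1; rewrite -eac /= => e; apply: (aut_inj ga); rewrite e pa.1.
Qed.

(** When the fixed trees of [g] and [h] meet, the projections of [x] to them lie
    on one geodesic starting at [x], and the farther one is in both trees. *)
Lemma fixed_proj_chain (g h : V -> V) x p q z : Aut_tree adj g -> Aut_tree adj h ->
  fixed_proj g x p -> fixed_proj h x q -> g z = z -> h z = z ->
  (D x p <= D x q)%N -> g q = q /\ D x q = (D x p + D p q)%N.
Proof.
move=> ga ha pp pq gz hz le.
have e1 := fixed_proj_geod ga pp gz; have e2 := fixed_proj_geod ha pq hz.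
have [|q' d1 d2] := @geod_point _ _ _ tr p z (D x q - D x p)%N; first lia.
have gq' : g q' = q' by apply: (fixed_convex ga pp.1 gz); rewrite d1.
have t1 := dist_triangle tr x p q'; have t2 := dist_triangle tr x q' z.
have qq : q' = q by apply: (@geod_unique _ _ _ tr x z); lia.
by split; [rewrite -qq|rewrite qq in d1; rewrite d1; lia].
Qed.

(** An automorphism [w] that fixes no vertex and displaces every vertex by an
    even distance translates a ray: from a vertex of minimal displacement, step
    repeatedly towards the image under [w]. *)
Lemma hyperbolic_axis (w : V -> V) : Aut_tree adj w ->
  (forall x, w x <> x) -> (forall x, ~~ odd (D x (w x))) ->
  exists a l, [/\ nbray adj a, (0 < l)%N & forall k, w (a k) = a (k + l)%N].
Proof.
move=> wa nofix even.
have [x0] := tree_nonempty tr.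
pose P n := `[< exists x, D x (w x) = n >].
have exP : exists n, P n by exists (D x0 (w x0)); apply/asboolP; exists x0.
case: (ex_minnP exP) => l /asboolP[x ex] min.
have ge y : (l <= D y (w y))%N by apply: min; apply/asboolP; exists y.
(* [l = 1] would be an inversion, which displaces [x] by an odd distance. *)
have l2 : (1 < l)%N.
  have : l <> 0%N by move=> l0; apply: (nofix x); apply/esym/(dist_eq0 tr); rewrite ex.
  by have := even x; rewrite ex; case: l {ex min ge} => [|[|]].
have [nx nxP] : {nx & forall y, adj y (nx y) /\ D y (w y) = (D (nx y) (w y)).+1}.
  apply: (@choice _ _ (fun y z => adj y z /\ D y (w y) = (D z (w y)).+1)) => y.
  have /eqP ne := nofix y; rewrite eq_sym in ne.
  by have [z a e] := closer_exists tr ne; exists z.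
have nxE y z : adj y z -> (D z (w y) < D y (w y))%N -> z = nx y.
  move=> a lt; have [a' e] := nxP y.
  by apply: (@closer_unique _ _ _ tr y (w y)); rewrite //; lia.
pose M y := D y (w y) = l.
have Mnx y : M y -> M (nx y).
  move=> My; have [a e] := nxP y; have := ge (nx y).
  have := dist_triangle tr (nx y) (w y) (w (nx y)).
  by rewrite /M [D (w y) _]aut_dist // (dist_adj tr a); rewrite /M in My; lia.
have Mit k y : M y -> M (iter k nx y) by move=> My; elim: k => //= k; exact: Mnx.
(* The geodesic from [y] to [w y] is followed by the first [l] iterates of
   [nx]: the step towards [w y] is also a step towards the image under [w] of
   the current vertex. *)
have run y j : M y -> (j <= l)%N ->
    (D (iter j nx y) (w y) = l - j)%N /\ (D y (iter j nx y) <= j)%N.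
  move=> My; elim: j => [|j IH] jl; first by rewrite /= My subn0 (dist_refl tr).
  have [|e1 e2] := IH; first lia.
  set u := iter j nx y in e1 e2 *; have Mu : M u by exact: Mit.
  have ne : u != w y by apply/eqP => e; move: e1; rewrite e (dist_refl tr); lia.
  have [u' a e] := closer_exists tr ne; rewrite e1 in e.
  have t := dist_triangle tr u' (w y) (w u).
  rewrite [D (w y) _]aut_dist // in t.
  have uE : u' = nx u by apply: nxE => //; rewrite Mu; lia.
  rewrite iterS -/u -uE; split; first lia.
  by have := dist_triangle tr y u u'; rewrite (dist_adj tr a); lia.
exists (fun k => iter k nx x), l; split; [|lia|].
- move=> k /=; set y := iter k nx x; have My : M y by exact: Mit.
  split; first exact: (nxP y).1.
  have [] := run y 2%N My l2; rewrite /= => e _.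
  by apply/eqP => e'; move: e; rewrite e' My; lia.
- move=> k; set y := iter k nx x; have My : M y by exact: Mit.
  have [] := run y l My (leqnn l); rewrite subnn => /(dist_eq0 tr) <- _.
  by rewrite /y addnC iterD.
Qed.

Variable K : set (V -> V).
Hypothesis Kgrp : subgroup_Aut adj K.

Lemma sub_aut g : K g -> Aut_tree adj g.
Proof. by case: Kgrp => + _ _ _; apply. Qed.

Lemma sub_inv g : K g -> exists2 h, K h & cancel g h /\ cancel h g.
Proof.
move=> Kg; have [h _ [gK hK]] := aut_inverse (sub_aut Kg).
by exists h => //; case: Kgrp => _ _ _; apply; first exact: Kg.
Qed.

Lemma sub_comp g h : K g -> K h -> K (g \o h).
Proof. by case: Kgrp => _ _ + _; apply. Qed.

Lemma sub_iter g n : K g -> K (iter n g).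
Proof.
move=> Kg; elim: n => [|n IH]; first by case: Kgrp.
exact: (sub_comp Kg IH).
Qed.

(** Two elements of [K] have a common fixed vertex, so the projections of [x0]
    to the fixed trees of the elements of [K] form a chain. If the chain is
    bounded, its last element is fixed by [K]; otherwise it spans a ray. *)
Lemma elliptic_group (x0 : V) : (forall g, K g -> exists x, g x = x) ->
  (exists x, forall g, K g -> g x = x) \/
  exists a, [/\ nbray adj a,
    forall g, K g -> exists m, forall k, (m <= k)%N -> g (a k) = a k &
    forall n, exists2 g, K g &
      exists m, [/\ (n <= m)%N, g (a m.+1) = a m.+1 & g (a m) <> a m]].
Proof.
move=> ell.
have meet g h : K g -> K h -> exists x, g x = x /\ h x = x.
  move=> Kg Kh; apply: fixed_meet; do ?[exact: sub_aut|exact: ell].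
  exact/ell/sub_comp.
have chain g h p q : K g -> K h -> fixed_proj g x0 p -> fixed_proj h x0 q ->
    (D x0 p <= D x0 q)%N -> g q = q /\ D x0 q = (D x0 p + D p q)%N.
  move=> Kg Kh pp pq; have [z [gz hz]] := meet g h Kg Kh.
  exact: (fixed_proj_chain (sub_aut Kg) (sub_aut Kh) pp pq gz hz).
have [[N bd]|unbd] := pselect
    (exists N, forall g p, K g -> fixed_proj g x0 p -> (D x0 p <= N)%N).
  left.
  pose P n := `[< exists g p, [/\ K g, fixed_proj g x0 p & D x0 p = n] >].
  have exP : exists n, P n.
    have Kid : K id by case: Kgrp.
    have [p pp] := fixed_proj_exists x0 (ell _ Kid).
    by exists (D x0 p); apply/asboolP; exists id, p.
  have bP n : P n -> (n <= N)%N by move=> /asboolP[g [p [Kg pp <-]]]; exact: bd pp.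
  case: (ex_maxnP exP bP) => n /asboolP[h [q [Kh pq qn]]] max; exists q => g Kg.
  have [p pp] := fixed_proj_exists x0 (ell _ Kg).
  have [] := chain g h p q Kg Kh pp pq => //.
  by rewrite qn; apply: max; apply/asboolP; exists g, p.
right.
(* [S n y]: the vertex [y] lies on the geodesic from [x0] to a projection, at
   distance [n] from [x0]. *)
pose S n y := exists g p, [/\ K g, fixed_proj g x0 p, D x0 y = n &
  D x0 p = (n + D y p)%N].
have Suniq n y y' : S n y -> S n y' -> y = y'.
  move=> [g [p [Kg pp ey ep]]] [h [q [Kh pq ey' eq]]].
  case: (leqP (D x0 p) (D x0 q)) => [le|/ltnW le].
    have [_ e] := chain g h p q Kg Kh pp pq le.
    have := dist_triangle tr y p q; have := dist_triangle tr x0 y q => t1 t2.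
    by apply: (@geod_unique _ _ _ tr x0 q); lia.
  have [_ e] := chain h g q p Kh Kg pq pp le.
  have := dist_triangle tr y' q p; have := dist_triangle tr x0 y' p => t1 t2.
  by apply: (@geod_unique _ _ _ tr x0 p); lia.
have far n : exists g p, [/\ K g, fixed_proj g x0 p & (n <= D x0 p)%N].
  apply/not_existsP => H; apply: unbd; exists n => g p Kg pp.
  rewrite leqNgt; apply/negP => lt; apply: (H g); exists p; split=> //; lia.
have [a Sa] : {a & forall n, S n (a n)}.
  apply: (@choice _ _ S) => n; have [g [p [Kg pp le]]] := far n.
  by have [y e1 e2] := geod_point tr le; exists y, g, p.
have da n : D x0 (a n) = n by have [g [p []]] := Sa n.
have aad n : adj (a n) (a n.+1).
  have [g [p [Kg pp ey ep]]] := Sa n.+1.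
  have ne : a n.+1 != x0.
    by apply/eqP => e; move: ey; rewrite e (dist_refl tr).
  have [r ar er] := closer_exists tr ne; rewrite -!(dist_sym tr x0) ey in er.
  rewrite (Suniq n (a n) r) //; first exact: (adj_sym tr).
  exists g, p; split=> //; first lia.
  have := dist_triangle tr x0 r p; have := dist_triangle tr r (a n.+1) p.
  by rewrite (dist_adj tr (adj_sym tr ar)); lia.
have na : nbray adj a.
  by split=> //; apply/eqP => e; have := da n.+2; rewrite e da; lia.
have pa g p : K g -> fixed_proj g x0 p -> a (D x0 p) = p.
  move=> Kg pp; apply: (Suniq (D x0 p)) => //; exists g, p; split=> //.
  by rewrite (dist_refl tr) addn0.
exists a; split=> //.
- move=> g Kg; have [p pp] := fixed_proj_exists x0 (ell _ Kg).
  exists (D x0 p) => k le; have [h [q [Kh pq ek eq]]] := Sa k.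
  have [|gq e] := chain g h p q Kg Kh pp pq; first lia.
  apply: (fixed_convex (sub_aut Kg) pp.1 gq).
  have := nbray_dist tr (D x0 p) (k - D x0 p) na; rewrite subnKC // (pa g) //; lia.
- move=> n; have [g [p [Kg pp le]]] := far n.+1; exists g => //.
  have ep := pa g p Kg pp.
  exists (D x0 p).-1; rewrite prednK; last lia.
  split; [lia|by rewrite ep pp.1|].
  by move=> /pp.2; rewrite da; lia.
Qed.

End TreeAutomorphisms.

(** * Point stabilizers of a primitive group *)

(** Two distinct points have stabilizers that generate [F]. Otherwise the two
    stabilizers, being maximal, coincide and are normal in [F], so that they fix
    all points and are trivial; then [F] has prime order. *)
Lemma primitive_stab_generate (d : nat) (F L : {group {perm 'I_d}}) (a b : 'I_d) :
  [primitive F, on [set: 'I_d]%SET | 'P] -> ~~ (cyclic F && prime #|F|) ->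
  a != b -> L \subset F ->
  (forall s : {perm 'I_d}, s \in F -> s a = a -> s \in L) ->
  (forall s : {perm 'I_d}, s \in F -> s b = b -> s \in L) ->
  F \subset L.
Proof.
move=> prim ncp nab sLF La Lb.
have tr : [transitive F, on [set: 'I_d]%SET | 'P] by case/andP: prim.
have max x (M : {group {perm 'I_d}}) : 'C_F[x | 'P]%g \subset M -> M \subset F ->
    M :=: 'C_F[x | 'P]%g \/ M :=: F.
  have xT : x \in [set: 'I_d]%SET by rewrite inE.
  move: prim; rewrite (trans_prim_astab xT tr) => /maximal_eqP[_ /(_ M) m] s1 s2.
  by have [->|->] := m s1 s2; [left|right].
have memC x (s : {perm 'I_d}) : (s \in 'C_F[x | 'P]%g) = (s \in F) && (s x == x).
  rewrite inE; congr (_ && _).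
  by apply/astab1P/eqP; rewrite /= apermE.
have sLa : 'C_F[a | 'P]%g \subset L.
  by apply/fintype.subsetP => s; rewrite memC => /andP[sF /eqP]; exact: La.
have [L1|->//] := max a L sLa sLF.
have sLb : 'C_F[b | 'P]%g \subset L.
  by apply/fintype.subsetP => s; rewrite memC => /andP[sF /eqP]; exact: Lb.
have [L2|->//] := max b L sLb sLF.
have trans x y : exists2 f : {perm 'I_d}, f \in F & f x = y.
  have /(atransP2 tr) H : x \in [set: 'I_d]%SET by rewrite inE.
  by have [|f fF ->] := H y; [rewrite inE|exists f].
have conjC x (f : {perm 'I_d}) : f \in F ->
    ('C_F[x | 'P] :^ f)%g = ('C_F[f x | 'P])%g.
  move=> fF; rewrite conjIg (conjGid fF); congr (_ :&: _)%g.
  by rewrite -(astab1_act 'P) /= apermE.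
have [f fF fab] := trans a b.
have nM : F \subset 'N(L)%g.
  have sLN : 'C_F[a | 'P]%g \subset (F :&: 'N(L))%g by rewrite -L1 finset.subsetI sLF normG.
  have [N1|/finset.setIidPl //] := max a (F :&: 'N(L))%G sLN (finset.subsetIl _ _).
  have : f \in 'C_F[a | 'P]%g.
    rewrite -N1 inE fF /=; apply/normP.
    by rewrite {1}L1 conjC // fab -L2.
  by rewrite memC fab => /andP[_]; rewrite eq_sym (negbTE nab).
have LC x : L :=: 'C_F[x | 'P]%g.
  have [g gF <-] := trans a x.
  by rewrite -conjC // -L1; apply/esym/normP/(fintype.subsetP nM).
have L0 : L :=: 1%g.
  apply/trivgP/fintype.subsetP => s sL; rewrite inE; apply/eqP/permP => x.
  by move: sL; rewrite (LC x) memC perm1 => /andP[_ /eqP].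
have f1 : f != 1%g by apply: contraNneq nab => f1; rewrite -fab f1 perm1.
have cF : (1 < #|F|)%N by rewrite cardG_gt1; apply/trivgPn; exists f.
have [x xF ox] := Cauchy (pdiv_prime cF) (pdiv_dvd #|F|).
have [||C1|C1] := max a <[x]>%G.
- by rewrite /= -L1 L0 sub1G.
- by rewrite cycle_subG.
- have /eqP : <[x]>%g = 1%g by rewrite -L0 L1 -C1.
  rewrite cycle_eq1 => /eqP x1; move: ox; rewrite x1 order1 => e.
  by have := pdiv_prime cF; rewrite -e.
- case/negP: ncp; rewrite -C1 /= cycle_cyclic /= -/(#[x]%g) ox.
  exact: pdiv_prime.
Qed.

(** * Legal colorings and the groups [U(F)] and [U(F)+] *)

Section Coloring.
Variables (V : discreteTopologicalType) (adj : rel V) (d : nat) (i : set V -> 'I_d).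
Hypothesis tr : regular_tree adj d.
Hypothesis legal : legal_coloring adj i.

Local Notation D := (dist adj).
Local Notation col x y := (i [set x; y]).

Lemma starP x E : star adj x E <-> exists2 y, adj x y & E = [set x; y].
Proof.
split=> [[[u [w [a ->]]]]|[y a ->]]; last first.
  by split; [exists x, y|left].
case=> /= ->; first by exists w.
by exists u; [exact: (adj_sym tr)|rewrite setUC].
Qed.

Lemma col_sym x y : col x y = col y x.
Proof. by rewrite setUC. Qed.

Lemma col_inj x y z : adj x y -> adj x z -> col x y = col x z -> y = z.
Proof.
move=> ay az e; have [_ inj _] := legal x.
have eq : [set x; y] = [set x; z].
  by apply: inj; rewrite ?inE //; apply/starP; [exists y|exists z].
have : [set x; z] y by rewrite -eq; right.
by case=> //= yx; move: ay; rewrite yx (tree_irrefl tr).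
Qed.

Lemma col_surj x c : exists y, adj x y /\ col x y = c.
Proof.
have [_ _ surj] := legal x; have [E /starP[y a ->] <-] := surj c I.
by exists y.
Qed.

(** The neighbour of [x] along the edge of color [c]. *)
Definition nbr (x : V) (c : 'I_d) : V := xget x [set y | adj x y /\ col x y = c].

Lemma nbrP x c : adj x (nbr x c) /\ col x (nbr x c) = c.
Proof.
rewrite /nbr; case: xgetP => [y _ //|H].
by have [y Py] := col_surj x c; case: (H y).
Qed.

Lemma nbr_adj x c : adj x (nbr x c). Proof. exact: (nbrP x c).1. Qed.

Lemma nbr_col x c : col x (nbr x c) = c. Proof. exact: (nbrP x c).2. Qed.

Lemma nbrE x y : adj x y -> nbr x (col x y) = y.
Proof.
by move=> a; apply: (col_inj (nbr_adj _ _) a); rewrite nbr_col.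
Qed.

Lemma nbrK c : cancel (nbr^~ c) (nbr^~ c).
Proof.
by move=> x; rewrite -[in X in nbr _ X](nbr_col x c) col_sym nbrE // (adj_sym tr) // nbr_adj.
Qed.

(** The end of the walk from [x] along the edges colored by [s]. *)
Definition walk (x : V) (s : seq 'I_d) : V := foldl nbr x s.

Lemma walk_cat x s t : walk x (s ++ t) = walk (walk x s) t.
Proof. exact: foldl_cat. Qed.

Lemma walk_rcons x s c : walk x (rcons s c) = nbr (walk x s) c.
Proof. by rewrite -cats1 walk_cat. Qed.

Lemma walk_rev x s : walk (walk x s) (rev s) = x.
Proof.
elim/last_ind: s x => [//|s c IH] x.
by rewrite rev_rcons walk_rcons /= nbrK IH.
Qed.

Lemma walk_surj x y : exists s, walk x s = y.
Proof.
have [p [pp <-]] := tree_connected tr x y; elim: p x pp => [|z p IH] x /=.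
  by exists [::].
by case/andP=> a /IH[s <-]; exists (col x z :: s); rewrite /= nbrE.
Qed.

(** A word without two equal consecutive letters labels a geodesic. *)
Lemma walk_reduced x s c : sorted (fun a b : 'I_d => a != b) (rcons s c) ->
  D x (walk x s) = size s /\ D x (walk x (rcons s c)) = (size s).+1.
Proof.
elim/last_ind: s c => [|s b IH] c /=.
  by rewrite (dist_refl tr) (dist_adj tr) // nbr_adj.
move=> srt; have [srt' bc] : sorted (fun a b : 'I_d => a != b) (rcons s b) /\ b != c.
  move: srt; case: (s) => [|e t] /=; first by rewrite andbT.
  by rewrite rcons_path last_rcons => /andP[].
have [d1 d2] := IH b srt'; rewrite size_rcons d2; split=> //.
rewrite [walk x (rcons _ c)]walk_rcons; set u := walk x (rcons s b) in d2 *.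
have ub : nbr u b = walk x s by rewrite /u walk_rcons nbrK.
rewrite (dist_forward tr (nbr_adj u b) _ (nbr_adj u c)) ?ub ?d1 ?d2 //.
by rewrite -ub; apply: contra bc => /eqP e; rewrite -(nbr_col u b) -(nbr_col u c) e.
Qed.

Lemma unsorted_split (s : seq 'I_d) : ~~ sorted (fun a b : 'I_d => a != b) s ->
  exists s1 c s2, s = s1 ++ c :: c :: s2.
Proof.
elim: s => [//|a [//|b s] IH] /=; rewrite negb_and negbK => /orP[/eqP ->|/IH].
  by exists [::], b, s.
by case=> s1 [c [s2 ->]]; exists (a :: s1), c, s2.
Qed.

(** Permuting the colors of a closed walk gives a closed walk, because both
    words reduce to the empty word. *)
Lemma walk_closed_map (f : 'I_d -> 'I_d) x y s :
  walk x s = x -> walk y (map f s) = y.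
Proof.
have [n] := ubnP (size s); elim: n s => // n IH s sn ws.
have [srt|/unsorted_split[s1 [c [s2 es]]]] := boolP (sorted (fun a b : 'I_d => a != b) s).
  case/lastP: s srt ws {sn} => [//|s c] srt ws.
  by have [_] := walk_reduced x srt; rewrite ws (dist_refl tr).
rewrite es size_cat /= in sn.
have := IH (s1 ++ s2); rewrite es size_cat !map_cat !walk_cat /= !nbrK => -> //; first lia.
by move: ws; rewrite es walk_cat /= nbrK.
Qed.

Lemma walk_eq_map (f : 'I_d -> 'I_d) x y s t :
  walk x s = walk x t -> walk y (map f s) = walk y (map f t).
Proof.
move=> e; have : walk y (map f (s ++ rev t)) = y.
  by apply: (@walk_closed_map _ x); rewrite walk_cat e walk_rev.
rewrite map_cat walk_cat map_rev => e2.
by rewrite -{1}[map f t]revK -[in RHS]e2 walk_rev.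
Qed.

(** The map sending [x] to [y] and permuting the colors of all edges by [f]. *)
Lemma color_map_exists (f : 'I_d -> 'I_d) x y :
  exists g : V -> V, forall s, g (walk x s) = walk y (map f s).
Proof.
have [w wP] := choice (walk_surj x).
by exists (fun z => walk y (map f (w z))) => s; apply: (@walk_eq_map _ x); rewrite wP.
Qed.

Lemma color_aut_exists (s : {perm 'I_d}) x y : exists g : V -> V,
  [/\ Aut_tree adj g, g x = y &
    forall u w, adj u w -> col (g u) (g w) = s (col u w)].
Proof.
have [g gP] := color_map_exists s x y.
have [h hP] := color_map_exists (s^-1)%g y x.
have nbrg u w : adj u w -> g w = nbr (g u) (s (col u w)).
  move=> a; have [t et] := walk_surj x u.
  by rewrite -{1}(nbrE a) -et -walk_rcons !gP map_rcons walk_rcons.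
have gadj u w : adj u w -> adj (g u) (g w).
  by move=> a; rewrite (nbrg u w a) nbr_adj.
have hadj u w : adj u w -> adj (h u) (h w).
  move=> a; have [t et] := walk_surj y u.
  rewrite -(nbrE a) -et -walk_rcons !hP map_rcons walk_rcons; exact: nbr_adj.
have gK : cancel g h.
  move=> u; have [t <-] := walk_surj x u; rewrite gP hP -map_comp.
  by rewrite map_id_in // => c _ /=; rewrite permK.
have hK : cancel h g.
  move=> u; have [t <-] := walk_surj y u; rewrite hP gP -map_comp.
  by rewrite map_id_in // => c _ /=; rewrite permKV.
exists g; split.
- split; first by exists h.
  by move=> u w; apply/idP/idP => [/hadj|/gadj //]; rewrite !gK.
- exact: (gP [::]).
- by move=> u w a; rewrite (nbrg u w a) nbr_col.
Qed.

Variable F : {group {perm 'I_d}}.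
Local Notation U := (universal_group adj i F).
Local Notation G := (universal_group_plus adj i F).

(** The local condition in terms of neighbours instead of edges. *)
Lemma universalP (g : V -> V) : U g <-> Aut_tree adj g /\
  forall x, exists2 s : {perm 'I_d}, s \in F &
    forall y, adj x y -> col (g x) (g y) = s (col x y).
Proof.
split=> -[ga H]; split=> // x; have [s sF sP] := H x; exists s => //.
  move=> y a; rewrite -sP; last by apply/starP; exists y.
  by rewrite image_setU !image_set1.
by move=> E /starP[y a ->]; rewrite image_setU !image_set1 sP.
Qed.

Lemma Aut_subgroup : subgroup_Aut adj (Aut_tree adj).
Proof.
split=> //.
- by split=> //; exists id.
- move=> g h [gb ga] [hb ha]; split; first exact: bij_comp.
  by move=> x y /=; rewrite ga ha.
- by move=> g h [_ ga] gK hK; split=> [|x y]; [exists g|rewrite -ga !hK].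
Qed.

Lemma universal_subgroup : subgroup_Aut adj U.
Proof.
have [_ A1 AM AV] := Aut_subgroup; split.
- by move=> g [].
- by apply/universalP; split=> // x; exists 1%g => // y _; rewrite perm1.
- move=> g h /universalP[ga gP] /universalP[ha hP]; apply/universalP.
  split=> [|x]; first exact: AM.
  have [s sF sP] := hP x; have [t tF tP] := gP (h x).
  exists (s * t)%g; first exact: groupM.
  by move=> y a /=; rewrite permM -sP // tP // ha.2.
- move=> g h /universalP[ga gP] gK hK; apply/universalP.
  split=> [|x]; first exact: (AV g).
  have [s sF sP] := gP (h x); exists s^-1%g; first by rewrite groupV.
  move=> y a; rewrite -{2}(hK x) -{2}(hK y) sP ?permK //.
  by rewrite -ga.2 !hK.
Qed.

Lemma plus_subgroup : subgroup_Aut adj G.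
Proof.
split.
- by apply: smallest_sub => [|g [[]]//]; exact: Aut_subgroup.
- by move=> A [[_ A1 _ _] _].
- move=> g h Gg Gh A AP; have [[_ _ AM _] _] := AP.
  by apply: AM; [apply: Gg|apply: Gh].
- move=> g h Gg gK hK A AP; have [[_ _ _ AV] _] := AP.
  by apply: (AV g) => //; apply: Gg.
Qed.

Lemma plus_universal g : G g -> U g.
Proof. by apply: smallest_sub => [|h []//]; exact: universal_subgroup. Qed.

Lemma edge_fixing_plus g x y : U g -> adj x y -> g x = x -> g y = y -> G g.
Proof.
move=> Ug a gx gy; apply: sub_gen_smallest; split=> //.
by exists [set x; y]; [exists x, y|move=> z [] /= ->].
Qed.

Lemma plus_minimal (K : set (V -> V)) : subgroup_Aut adj K ->
  (forall g x y, U g -> adj x y -> g x = x -> g y = y -> K g) ->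
  forall g, G g -> K g.
Proof.
move=> Kgrp gen; apply: smallest_sub => // g [Ug [E [x [y [a ->]]] fixE]].
by apply: (gen g x y) => //; apply: fixE; [left|right].
Qed.

(** [U(F)+] preserves the bipartition of the tree. *)
Lemma plus_even g x : G g -> ~~ odd (D x (g x)).
Proof.
move=> Gg; suff [_ /(_ x)] : [set g | Aut_tree adj g /\ forall x, ~~ odd (D x (g x))] g by [].
have [_ A1 AM AV] := Aut_subgroup; move: g Gg; apply: plus_minimal; first split.
- by move=> g [].
- by split=> // y; rewrite (dist_refl tr).
- move=> g h [ga gP] [ha hP]; split=> [|y]; first exact: AM.
  by rewrite (dist_parity tr y (h y)) /= (negbTE (hP y)) (negbTE (gP _)).
- move=> g h [ga gP] gK hK; split=> [|y]; first exact: (AV g).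
  by rewrite -{1}(hK y) (dist_sym tr) gP.
- move=> g u w [ga _] _ gu _; split=> // y.
  have e : D u (g y) = D y u by rewrite -{1}gu (aut_dist tr) // (dist_sym tr).
  by rewrite (dist_parity tr y u) e addbb.
Qed.

(** The map that agrees with [g] on the half-tree at [y] of the edge [x y] and
    is the identity on the other half-tree. *)
Definition half_map (x y : V) (g : V -> V) (z : V) : V :=
  if (D z y < D z x)%N then g z else z.

Lemma half_edge x y u w : adj x y -> adj u w -> (D u y < D u x)%N ->
  (D w x < D w y)%N -> u = y /\ w = x.
Proof.
move=> a a' l1 l2; have := @geod_cat _ _ _ tr u y x w (adj_sym tr a).
rewrite -!(dist_sym tr w) => /(_ l2 l1); rewrite (dist_sym tr w u) (dist_adj tr a') => e.
by split; apply: (dist_eq0 tr); lia.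
Qed.

Lemma half_map_local x y g u w : adj x y -> g x = x -> g y = y -> adj u w ->
  half_map x y g w = if (D u y < D u x)%N then g w else w.
Proof.
move=> a gx gy a'; rewrite /half_map.
have su := dist_step tr u a; have sw := dist_step tr w a.
case: (ltnP (D u y) (D u x)) => hu; case: (ltnP (D w y) (D w x)) => hw //.
  by have [|_ ->] := @half_edge x y u w a a' hu; [lia|].
by have [|-> _] := @half_edge x y w u a (adj_sym tr a') hw; [lia|].
Qed.

Lemma half_mapK x y g h : Aut_tree adj g -> g x = x -> g y = y -> cancel g h ->
  cancel (half_map x y g) (half_map x y h).
Proof.
move=> ga gx gy gK z; rewrite /half_map; case: (ltnP (D z y) (D z x)) => hz; last first.
  by rewrite ltnNge hz.
by rewrite -{1}gx -{1}gy !(aut_dist tr) // hz gK.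
Qed.

(** Tits' independence property. *)
Lemma half_map_universal x y g : adj x y -> U g -> g x = x -> g y = y ->
  U (half_map x y g).
Proof.
move=> a Ug gx gy; have [ga gP] := (universalP g).1 Ug.
have [h ha [gK hK]] := aut_inverse ga.
have hx : h x = x by rewrite -{1}gx gK.
have hy : h y = y by rewrite -{1}gy gK.
have pres f u w : Aut_tree adj f -> f x = x -> f y = y -> adj u w ->
    adj (half_map x y f u) (half_map x y f w).
  move=> fa fx fy a'; rewrite (half_map_local a fx fy a') /half_map.
  by case: ifP => // _; rewrite fa.2.
apply/universalP; split.
  split; first by exists (half_map x y h); apply: half_mapK.
  move=> u w; apply/idP/idP => [a'|]; last exact: pres.
  by have := pres h _ _ ha hx hy a'; rewrite !(half_mapK ga gx gy gK).
move=> u; case hu: (D u y < D u x)%N.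
  have [s sF sP] := gP u; exists s => // w a'.
  by rewrite (half_map_local a gx gy a') /half_map hu sP.
exists 1%g => // w a'.
by rewrite (half_map_local a gx gy a') /half_map hu perm1.
Qed.

(** * Subgroups containing the stabilizers of adjacent edges *)

Hypothesis prim : [primitive F, on [set: 'I_d]%SET | 'P].
Hypothesis ncyc : ~~ (cyclic F && prime #|F|).
Variable K : set (V -> V).
Hypothesis Kgrp : subgroup_Aut adj K.
Hypothesis KU : forall g, K g -> U g.

(** The permutations of the colors at [x] that are induced by elements of [K]
    fixing [x] form a group containing two point stabilizers of [F], so they form
    all of [F]; and an element of [U(F)] fixing the neighbours of [x] is in [K]. *)
Lemma vertex_stab_sub x y z : adj x y -> adj x z -> y != z ->
  (forall g, U g -> g x = x -> g y = y -> K g) ->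
  (forall g, U g -> g x = x -> g z = z -> K g) ->
  forall g, U g -> g x = x -> K g.
Proof.
move=> ay az nyz Ky Kz.
pose realizes (s : {perm 'I_d}) (k : V -> V) := [/\ K k, k x = x &
  forall w, adj x w -> col x (k w) = s (col x w)].
pose L := [set s in F | `[< exists k, realizes s k >]]%SET.
have memL s : s \in L <-> s \in F /\ exists k, realizes s k.
  by rewrite finset.inE; split=> [/andP[sF /asboolP]|[sF /asboolP e]] //; rewrite sF.
have Lgrp : group_set L.
  apply/group_setP; split.
    apply/memL; split=> //; exists id; split=> //; first by case: Kgrp.
    by move=> w _; rewrite perm1.
  move=> s t /memL[sF [k [Kk kx kP]]] /memL[tF [l [Kl lx lP]]].
  apply/memL; split; first exact: groupM.
  exists (l \o k); split; first exact: (sub_comp Kgrp).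
    by rewrite /= kx.
  by move=> w aw; rewrite permM -kP //= lP // -{1}kx (sub_aut Kgrp Kk).2.
have stab (w : V) : adj x w -> (forall g, U g -> g x = x -> g w = w -> K g) ->
    forall s : {perm 'I_d}, s \in F -> s (col x w) = col x w -> s \in group Lgrp.
  move=> aw Kw s sF sw; apply/memL; split=> //.
  have [k [ka kx kP]] := color_aut_exists s x x; exists k; split=> //.
    apply: Kw => //; first by apply/universalP; split=> // u; exists s => // v; exact: kP.
    apply: (@col_inj x) => //; first by rewrite -{1}kx ka.2.
    by rewrite -{1}kx kP.
  by move=> v av; rewrite -{1}kx kP.
have FL : F \subset group Lgrp.
  apply: (@primitive_stab_generate _ F _ (col x y) (col x z)) => //.
  - by apply: contra nyz => /eqP e; apply/eqP; apply: (col_inj ay az).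
  - by apply/fintype.subsetP => s /memL[].
  - exact: stab.
  - exact: stab.
move=> g Ug gx; have [ga gP] := (universalP g).1 Ug.
have [s sF sP] := gP x; have /memL[_ [k [Kk kx kP]]] := fintype.subsetP FL s sF.
have [h Kh [kK hK]] := sub_inv Kgrp Kk.
have hx : h x = x by rewrite -{1}kx kK.
have hgfix w : adj x w -> h (g w) = w.
  move=> aw; have [ha hab] := sub_aut Kgrp Kh.
  have a' : adj x (h (g w)) by rewrite -{1}hx hab -{1}gx ga.2.
  apply: (col_inj a' aw); apply: (@perm_inj _ s).
  by rewrite -kP // hK -sP // gx.
have Khg : K (h \o g).
  apply: Ky; last exact: hgfix.
  - by have [_ _ UM _] := universal_subgroup; apply: UM => //; exact: KU.
  - by rewrite /= gx hx.
have -> : g = k \o (h \o g) by apply/funext => w /=; rewrite hK.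
exact: (sub_comp Kgrp).
Qed.

(** [K] contains the stabilizer of [x] in [U(F)]. *)
Let full_at x := forall g, U g -> g x = x -> K g.

Lemma full_neighbour x y z : adj x y -> adj x z -> full_at x -> full_at y -> full_at z.
Proof.
move=> ay az fx fy g Ug gz.
have trF : [transitive F, on [set: 'I_d]%SET | 'P] by case/andP: prim.
have /(atransP2 trF) H : col x y \in [set: 'I_d]%SET by rewrite finset.inE.
have [|s sF es] := H (col x z); first by rewrite finset.inE.
have [k [ka kx kP]] := color_aut_exists s x x.
have Uk : U k by apply/universalP; split=> // u; exists s => // v; exact: kP.
have ky : k y = z.
  apply: (@col_inj x) => //; first by rewrite -{1}kx ka.2.
  by rewrite -{1}kx kP // es /= apermE.
have Kk : K k by exact: fx.
have [h Kh [kK hK]] := sub_inv Kgrp Kk.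
have -> : g = k \o ((h \o g) \o k) \o h by apply/funext => w /=; rewrite !hK.
have [_ _ UM _] := universal_subgroup.
apply: (sub_comp Kgrp) => //; apply: (sub_comp Kgrp) => //; apply: fy.
  by apply: (UM) => //; apply: (UM) => //; exact: KU.
by rewrite /= ky gz -ky kK.
Qed.

(** If [K] contains the stabilizers in [U(F)] of two adjacent vertices then it
    contains those of all their neighbours, hence of all vertices; these
    generate a group containing [U(F)+]. *)
Lemma plus_sub x y : adj x y -> full_at x -> full_at y -> forall g, G g -> K g.
Proof.
move=> a fx fy; have full u : full_at u.
  have [p [pp <-]] := tree_connected tr x u.
  elim: p x y a fx fy pp => [//|z p IH] x y a fx fy /= /andP[az].
  by apply: (IH z x) => //; [exact: (adj_sym tr)|exact: (full_neighbour a az)].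
by apply: plus_minimal => // g u w Ug _ gu _; exact: (full u).
Qed.

End Coloring.

(** * Subgroups of [U(F)+] satisfying a Mautner condition *)

Section EndStabilizers.
Variables (V : discreteTopologicalType) (adj : rel V) (d : nat).
Hypothesis tr : regular_tree adj d.

Local Notation D := (dist adj).

(** The end represented by the ray [a]. *)
Definition end_of (a : nat -> V) : set (nat -> V) :=
  [set s | ray adj s /\ cofinal a s].

Lemma end_of_tail (f : V -> V) a s m : Aut_tree adj f ->
  (forall k, (m <= k)%N -> f (a k) = a k) -> end_of a s -> end_of a (f \o s).
Proof.
move=> fa fix_tail [[inj ad] [p [q e]]]; split.
  split; first by move=> k l /(aut_inj fa) /inj.
  by move=> k /=; rewrite fa.2.
exists (p + m)%N, (q + m)%N => k /=.
by rewrite -[in RHS]addnA -e addnA fix_tail //; lia.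
Qed.

(** Fixing a vertex and the end of the ray [a] amounts to fixing a tail of [a]:
    seen from a fixed vertex, two tails of [a] that correspond to each other
    start at the same distance. *)
Lemma end_stab0P (A : set (V -> V)) a g : A `<=` Aut_tree adj -> nbray adj a ->
  end_stab0 A (end_of a) g <->
  A g /\ exists m, forall k, (m <= k)%N -> g (a k) = a k.
Proof.
move=> AA na; split=> [[Ag ge [x gx]]|[Ag [m fix_tail]]].
  split=> //; have ga := AA _ Ag.
  have [_ [m [n e]]] : end_of a (g \o a).
    rewrite -ge; exists a => //; split; first exact: (nbray_ray tr).
    by exists 0%N, 0%N.
  have [k0 up] := nbray_eventually_up tr x na.
  have eD : D x (a (k0 + m)%N) = D x (a (k0 + n)%N).
    by rewrite addnC e /= -{1}gx (aut_dist tr) // addnC.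
  have mn : m = n by move: eD; rewrite !(nbray_up tr na up); lia.
  by exists m => k le; have := e (k - m)%N; rewrite -mn subnKC //= => /esym.
have ga := AA _ Ag; have [h ha [gK hK]] := aut_inverse ga.
split=> //; last by exists (a m); exact: fix_tail.
apply/seteqP; split=> [_ [s es <-]|s es]; first exact: end_of_tail fix_tail es.
exists (h \o s); last by apply/funext => k /=; rewrite hK.
by apply: (@end_of_tail _ _ _ m ha _ es) => k le; rewrite -{1}(fix_tail k le) gK.
Qed.

End EndStabilizers.

Section MautnerSubgroup.
Variables (V : discreteTopologicalType) (adj : rel V) (d : nat) (i : set V -> 'I_d).
Variable F : {group {perm 'I_d}}.
Hypothesis tr : regular_tree adj d.
Hypothesis legal : legal_coloring adj i.
Hypothesis prim : [primitive F, on [set: 'I_d]%SET | 'P].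
Hypothesis ncyc : ~~ (cyclic F && prime #|F|).

Local Notation D := (dist adj).
Local Notation U := (universal_group adj i F).
Local Notation G := (universal_group_plus adj i F).

Variable K : set (V -> V).
Hypothesis Kgrp : subgroup_Aut adj K.
Hypothesis KG : K `<=` G.

(** The property of the vector stabilizers of a unitary representation that is
    used: [K] contains every [u] of [U(F)+] such that some products [h u g] with
    [g] and [h] in [K] tend to the identity. *)
Hypothesis limit_sub : forall x u, G u ->
  (forall N, exists g h, [/\ K g, K h &
    forall z, (D x z <= N)%N -> h (u (g z)) = z]) -> K u.

(** Conjugates [g^-1 u g] that tend to the identity. *)
Lemma mautner x u : G u ->
  (forall N, exists2 g, K g & forall z, (D x z <= N)%N -> u (g z) = g z) -> K u.
Proof.
move=> Gu H; apply: (limit_sub (x := x)) => // N.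
have [g Kg gP] := H N; have [h Kh [gK hK]] := sub_inv Kgrp Kg.
by exists g, h; split=> // z /gP ->.
Qed.

Lemma closed_sub x f : G f ->
  (forall N, exists2 g, K g & forall z, (D x z <= N)%N -> f z = g z) -> K f.
Proof.
move=> Gf H; apply: (limit_sub (x := x)) => // N.
have [g Kg gP] := H N; have [h Kh [gK hK]] := sub_inv Kgrp Kg.
exists id, h; split=> // [|z /gP ->//]; by case: Kgrp.
Qed.

Lemma half_map_plus x y g : adj x y -> U g -> g x = x -> g y = y ->
  G (half_map adj x y g).
Proof.
move=> a Ug gx gy; apply: (edge_fixing_plus (x := x) (y := y)) => //.
- exact: half_map_universal.
- by rewrite /half_map (dist_refl tr) ltn0.
- by rewrite /half_map; case: ifP.
Qed.

(** The translates of a half-tree of an edge of the axis by the powers of [w]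
    leave every ball, and so do the translates of the other half-tree by the
    negative powers, so [mautner] applies to both factors
    of [u], which move only one of the half-trees each. *)
Lemma axis_edge_sub w a l k u : K w -> nbray adj a -> (0 < l)%N ->
  (forall k, w (a k) = a (k + l)%N) ->
  U u -> u (a k) = a k -> u (a k.+1) = a k.+1 -> K u.
Proof.
move=> Kw na l0 wa Uu u0 u1; have ak := (na k).1; have ak' := adj_sym tr ak.
have wn n j : iter n w (a j) = a (j + n * l)%N.
  elim: n => [|n IH]; first by rewrite mul0n addn0.
  by rewrite iterS IH wa; congr (a _); lia.
have Kwn n : K (iter n w) by exact: (sub_iter Kgrp n Kw).
have wD n y z : D (iter n w y) (iter n w z) = D y z.
  by apply: (aut_dist tr); exact: (sub_aut Kgrp (Kwn n)).
have K1 : K (half_map adj (a k) (a k.+1) u).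
  apply: (mautner (x := a k)); first exact: half_map_plus.
  move=> N; have [g Kg [wK gK]] := sub_inv Kgrp (Kwn N); exists g => // z le.
  rewrite /half_map ifF // -(wD N) -[X in (_ < X)%N](wD N) gK !wn.
  have nk := nbray_shift k na.
  have far : (D z (a (k + N * l)%N) < D z (a (k + (N * l).+1)%N))%N.
    apply: (nbray_far tr nk); rewrite /= addn0; exact: (leq_trans le (leq_pmulr N l0)).
  by apply/negbTE; rewrite -leqNgt addSnnS addnS -addnS ltnW.
have K2 : K (half_map adj (a k.+1) (a k) u).
  apply: (mautner (x := a k)); first exact: half_map_plus.
  move=> N; exists (iter N.+1 w) => // z le.
  rewrite /half_map ifF //; apply/negbTE/negP => up.
  have := nbray_up tr na up (N.+1 * l); rewrite -wn wD (dist_sym tr z).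
  have := leq_pmulr N.+1 l0; lia.
suff -> : u = half_map adj (a k) (a k.+1) u \o half_map adj (a k.+1) (a k) u.
  exact: (sub_comp Kgrp).
have [ua _] := Uu.
apply/funext => z /=; rewrite /half_map.
case: (ltnP (D z (a k)) (D z (a k.+1))) => h.
  by rewrite -{1}u0 -{1}u1 !(aut_dist tr) // ltnNge (ltnW h).
by have := dist_step tr z ak; case: (ltnP (D z (a k.+1)) (D z (a k))) => //; lia.
Qed.

Lemma hyperbolic_full w : K w -> (forall x, w x <> x) -> forall g, G g -> K g.
Proof.
move=> Kw nofix.
have [|a [l [na l0 wa]]] := hyperbolic_axis tr (sub_aut Kgrp Kw) nofix.
  by move=> x; exact: (plus_even tr x (KG Kw)).
have KU g : K g -> U g by move=> /KG; exact: plus_universal.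
have full k g : U g -> g (a k.+1) = a k.+1 -> K g.
  apply: (vertex_stab_sub tr legal prim ncyc Kgrp KU (adj_sym tr (na k).1) (na k.+1).1).
  - by rewrite eq_sym (na k).2.
  - by move=> f Uf f1 f0; exact: (axis_edge_sub Kw na l0 wa Uf f0 f1).
  - by move=> f Uf f1 f0; exact: (axis_edge_sub Kw na l0 wa Uf f1 f0).
exact: (plus_sub tr legal prim Kgrp KU (na 1%N).1 (full 0%N) (full 1%N)).
Qed.

(** The element [g] of [K] fixes [a m.+1] and moves [a m]. It maps the ball
    around [a 0], which lies behind [a m], to a branch at [a m.+1] other than
    that of [a m], hence into the half-tree fixed by [u]. *)
Lemma half_tree_fixer_sub a n u : nbray adj a ->
  (forall n, exists2 g, K g &
    exists m, [/\ (n <= m)%N, g (a m.+1) = a m.+1 & g (a m) <> a m]) ->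
  G u -> (forall z, (D z (a n.+1) < D z (a n))%N -> u z = z) -> K u.
Proof.
move=> na moving Gu fixu; apply: (mautner (x := a 0%N)) => // N.
have [g Kg [m [le gm1 gm]]] := moving (N + n)%N; exists g => // z lez.
have ga := sub_aut Kgrp Kg.
apply: fixu; case: (dist_step tr (g z) (na n).1) => [up|->//]; exfalso; apply: gm.
have lt : (D (g z) (a m) < D (g z) (a m.+1))%N.
  by apply: (nbray_up_lt tr na (k := n)); lia.
have far : (D z (a m) < D z (a m.+1))%N by apply: (nbray_far tr na); lia.
rewrite -(aut_dist tr z (a m) ga) -(aut_dist tr z (a m.+1) ga) gm1 in far.
apply: (@closer_unique _ _ _ tr (a m.+1) (g z)).
- by rewrite -gm1 ga.2; exact/(adj_sym tr)/(na m).1.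
- exact/(adj_sym tr)/(na m).1.
- by rewrite -!(dist_sym tr (g z)) ltnW.
- by rewrite -!(dist_sym tr (g z)) ltnW.
Qed.

(** A subgroup with this property is [U(F)+], or fixes a vertex, or is the
    stabilizer of an end among the elements that fix a vertex. *)
Lemma mautner_subgroup : ~ (forall g, G g -> K g) ->
  (exists x, forall g, K g -> g x = x) \/
  exists2 eta, ends adj eta & K = end_stab0 G eta.
Proof.
move=> proper.
have ell g : K g -> exists x, g x = x.
  move=> Kg; apply/not_existsP => nofix; exact/proper/(hyperbolic_full Kg).
have [x0] := tree_nonempty tr.
have [|[a [na tails moving]]] := elliptic_group tr Kgrp x0 ell; first by left.
right; exists (end_of adj a).
  by exists a => //; exact: (nbray_ray tr).
have GA : G `<=` Aut_tree adj.
  by case: (plus_subgroup adj i F).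
apply/seteqP; split=> [g Kg|f /(end_stab0P tr f GA na)[Gf [m fixf]]].
  by apply/(end_stab0P tr g GA na); split; [exact: KG|exact: tails].
have Uf := plus_universal tr Gf.
apply: (closed_sub (x := a 0%N)) => // N.
set n := maxn m N; have an := adj_sym tr (na n).1.
exists (half_map adj (a n.+1) (a n) f) => [|z le]; last first.
  rewrite /half_map (nbray_far tr na) //; lia.
apply: (half_tree_fixer_sub (n := n) na moving).
- by apply: half_map_plus => //; apply: fixf; lia.
- by move=> z lt; rewrite /half_map ltnNge ltnW.
Qed.

End MautnerSubgroup.

(** * The compact-open topology on self-maps of a discrete space *)

Section CompactOpen.
Variable V : discreteTopologicalType.

Lemma nbhs_discrete (z : V) (A : set V) : A z -> nbhs z A.
Proof. by rewrite nbhs_principalE => Az; apply/principal_filterP. Qed.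

(** A filter that is eventually constant at each point is eventually constant
    on each compact, that is finite, set. *)
Lemma ptws_agree_compact (F : set_system (V -> V)) (f : V -> V) (A : set V) :
  Filter F -> (forall z, F [set g | g z = f z]) -> compact A ->
  F [set g | forall z, A z -> g z = f z].
Proof.
move=> FF Ff /compact_near_coveringP/(_ _ F (fun g z => g z = f z) FF) cA.
apply: filterS (cA _) => [g sub z /sub //|z Az].
exists ([set z], [set g | g z = f z]); first by split; [exact: nbhs_discrete|exact: Ff].
by move=> [u g] [/= -> ].
Qed.

Lemma ptws_agree_cvg (F : set_system {compact-open, V -> V})
    (f : {compact-open, V -> V}) : Filter F ->
  (forall z : V, F [set g : V -> V | g z = f z]) -> F --> f.
Proof.
move=> FF Ff; apply/compact_open_cvgP => A O cA _ sub.
apply: filterS (ptws_agree_compact FF Ff cA) => g gf _ [z Az <-].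
by rewrite gf //; apply: sub; exists z.
Qed.

(** Tychonoff's theorem: an ultrafilter of maps whose values at each point lie
    in a finite set is eventually constant at each point. *)
Lemma ultra_finite_limit (F : set_system (V -> V)) (A : V -> set V) :
  UltraFilter F -> (forall z, finite_set (A z)) ->
  F [set g | forall z, A z (g z)] -> exists f, forall z, F [set g : V -> V | g z = f z].
Proof.
move=> UF finA FA.
have := @tychonoff V (fun=> V) A (fun z => finite_compact (finA z)).
rewrite compact_ultra => /(_ F UF FA) [f [_ Ff]]; exists f => z.
have /= := cvg_trans (cvg_app (@proj V (fun=> V) z) Ff) (@proj_continuous V (fun=> V) z f).
by move=> /(_ [set f z]); apply; exact: nbhs_discrete.
Qed.

End CompactOpen.

(** * Vertex stabilizers in [U(F)+] *)

Section VertexStabilizers.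
Variables (V : discreteTopologicalType) (adj : rel V) (d : nat) (i : set V -> 'I_d).
Variable F : {group {perm 'I_d}}.
Hypothesis tr : regular_tree adj d.

Local Notation D := (dist adj).
Local Notation U := (universal_group adj i F).
Local Notation G := (universal_group_plus adj i F).

Lemma ball_finite x N : finite_set [set z | (D x z <= N)%N].
Proof.
elim: N => [|N IH].
  apply: (sub_finite_set (B := [set x])) => [z /=|]; last exact: finite_set1.
  by rewrite leqn0 => /eqP /(dist_eq0 tr) ->.
apply: (sub_finite_set (B := [set x] `|`
    \bigcup_(y in [set z | (D x z <= N)%N]) [set z | adj y z])).
  move=> z /= le; have [->|nzx] := eqVneq z x; [by left|right].
  have [y a e] := closer_exists tr nzx; rewrite -!(dist_sym tr x) in e.
  by exists y => /=; [lia|exact: (adj_sym tr)].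
rewrite finite_setU; split; first exact: finite_set1.
apply: bigcup_finite => // y _; apply/finite_setP; exists d.
exact: (tree_regular tr y).
Qed.

(** A pointwise limit [f] of elements of [U(F)+] fixing [x] is in [U(F)+]. It is
    onto because it preserves the spheres around [x], and it differs from an
    element of [U(F)+] by one that fixes an edge. *)
Lemma vertex_stab_closed x f :
  (forall N, exists g, [/\ G g, g x = x & forall z, (D x z <= N)%N -> f z = g z]) -> G f.
Proof.
move=> lim; have Gg := plus_subgroup adj i F.
have fD z : D x (f z) = D x z.
  have [g [/(sub_aut Gg) ga gx e]] := lim (D x z).
  by rewrite e // -{1}gx (aut_dist tr).
have agree2 u w : exists g, [/\ G g, g x = x, f u = g u & f w = g w].
  have [g [gG gx e]] := lim (maxn (D x u) (D x w)).
  by exists g; split=> //; apply: e; lia.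
have fx : f x = x by have [g [_ gx _ ->]] := agree2 x x.
have finj : injective f.
  by move=> u w; have [g [/(sub_aut Gg) ga _ -> ->]] := agree2 u w => /(aut_inj ga).
have [h hK] : {h : V -> V & forall y, f (h y) = y}.
  apply: (@choice _ _ (fun y z => f z = y)) => y.
  have [g [gG gx e]] := lim (D x y).
  have [h hG [gK hK]] := sub_inv Gg gG; exists (h y); rewrite e ?hK //.
  by rewrite -(aut_dist tr _ _ (sub_aut Gg gG)) gx hK.
have fa : Aut_tree adj f.
  split; first by exists h => // z; apply: finj; rewrite hK.
  by move=> u w; have [g [/(sub_aut Gg) ga _ -> ->]] := agree2 u w; exact: ga.2.
have Uf : U f.
  apply/(universalP i tr); split=> // u.
  have [g [gG gx e]] := lim (D x u).+1.
  have [_ gP] := (universalP i tr _ _).1 (plus_universal tr gG).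
  have [s sF sP] := gP u; exists s => // w a.
  have := dist_triangle tr x u w; rewrite (dist_adj tr a) => le.
  by rewrite !e ?sP //; lia.
(* The degree [d] is positive because ['I_d] is inhabited by [i set0]. *)
have [y a] : exists y, adj x y.
  apply/not_existsP => none; have := tree_regular tr x.
  have -> : [set y | adj x y] = set0 by apply/seteqP; split=> // y /none.
  rewrite card_eq_sym card_eq0 => /eqP I0.
  have : `I_d 0%N by rewrite /=; exact: leq_ltn_trans (ltn_ord (i set0)).
  by rewrite I0.
have [g [gG gx e]] := lim 1%N; have [h1 h1G [gK h1K]] := sub_inv Gg gG.
have -> : f = g \o (h1 \o f) by apply/funext => z /=; rewrite h1K.
apply: (sub_comp Gg) => //; apply: (edge_fixing_plus (x := x) (y := y)) => //.
- have [_ _ UM _] := universal_subgroup i tr F.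
  by apply: UM => //; exact: plus_universal.
- by rewrite /= fx -{1}gx gK.
- by rewrite /= e ?gK // (dist_adj tr a).
Qed.

(** A subset of the stabilizer of a vertex that is closed under pointwise
    limits is compact, because the orbits are finite. *)
Lemma vertex_fixing_compact (K : set (V -> V)) x :
  (forall g, K g -> Aut_tree adj g) -> (forall g, K g -> g x = x) ->
  (forall f, (forall N, exists2 g, K g & forall z, (D x z <= N)%N -> f z = g z) -> K f) ->
  compact (K : set {compact-open, V -> V}).
Proof.
move=> Kaut Kx Kcl; rewrite compact_ultra => UF UFU UFK.
have [|f Ff] := @ultra_finite_limit V UF (fun z => [set y | (D x y <= D x z)%N])
    UFU (fun z => ball_finite x (D x z)).
  by apply: filterS UFK => g Kg z /=; rewrite -{1}(Kx g Kg) (aut_dist tr) //; exact: Kaut.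
exists f; split; last exact: ptws_agree_cvg.
apply: Kcl => N.
have FF : Filter UF by exact: ultra_proper.
have := ptws_agree_compact FF Ff (finite_compact (ball_finite x N)).
move=> /(filterI UFK) /filter_ex [g [Kg gP]]; exists g => // z le.
by rewrite gP.
Qed.

End VertexStabilizers.

(** * Stabilizers of vectors *)

Section VectorStabilizers.
Variables (R : realType) (H : completeNormedModType R[i]).
Variable ip : {dot H for @Num.conj R[i]}.
Hypothesis hil : hilbert_product ip.
Variables (V : discreteTopologicalType) (adj : rel V) (d : nat).
Hypothesis tr : regular_tree adj d.
Variable G : set (V -> V).
Hypothesis Ggrp : subgroup_Aut adj G.
Variable pi : (V -> V) -> {linear H -> H}.
Hypothesis rep : unitary_rep ip G pi.

Local Notation D := (dist adj).

Lemma rep_norm g u : G g -> `|pi g u| = `|u|.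
Proof.
move=> Gg; apply/eqP; rewrite -(@eqrXn2 _ 2%N) //.
by rewrite !hil (rep_ip rep).
Qed.

Lemma rep_id u : pi id u = u.
Proof.
have Gid : G id by case: Ggrp.
have [w <-] := rep_surj rep Gid u.
by rewrite -(rep_mul rep Gid Gid).
Qed.

Lemma vector_stab_subgroup v : subgroup_Aut adj (vector_stab G pi v).
Proof.
have [GA G1 GM GV] := Ggrp; split.
- by move=> g [/GA].
- by split=> //; exact: rep_id.
- by move=> g h [Gg gv] [Gh hv]; split; [exact: GM|rewrite (rep_mul rep) // hv].
- move=> g h [Gg gv] gK hK; have Gh : G h by exact: (GV g).
  split=> //; rewrite -{1}gv -(rep_mul rep) // (_ : h \o g = id) ?rep_id //.
  exact/funext.
Qed.

(** Elements of [G] that fix a large ball move [v] little. *)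
Lemma rep_continuous_at_id v x (e : R[i]) : 0 < e ->
  exists N, forall g, G g -> (forall z, (D x z <= N)%N -> g z = z) ->
    `|pi g v - v| < e.
Proof.
move=> e0; have Gid : G id by case: Ggrp.
pose B N := [set g : V -> V | forall z, (D x z <= N)%N -> g z = z].
pose Fl : set_system {compact-open, V -> V} := filter_from [set: nat] B.
have FF : Filter Fl.
  apply: filter_from_filter; first by exists 0%N.
  move=> m n _ _; exists (maxn m n) => // g gB; split=> z le; apply: gB; lia.
have Fid : Fl --> (id : {compact-open, V -> V}).
  by apply: ptws_agree_cvg => z; exists (D x z) => // g; apply.
have cont := @rep_cont _ _ _ _ _ _ rep v.
have := (subspace_continuousP _ _).1 cont id Gid.
move=> /cvgrPdist_lt /(_ e e0) /Fid [N _ NP]; exists N => g Gg gB.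
by have := NP g gB Gg; rewrite /from_subspace /= rep_id distrC.
Qed.

(** [pi (h u g) v - v] has the same norm as [pi u v - v] when [g] and [h] fix
    [v]. *)
Lemma vector_stab_limit v x u : G u ->
  (forall N, exists g h, [/\ vector_stab G pi v g, vector_stab G pi v h &
    forall z, (D x z <= N)%N -> h (u (g z)) = z]) -> vector_stab G pi v u.
Proof.
move=> Gu lim; split=> //; have [_ _ GM _] := Ggrp.
apply/eqP; rewrite -subr_eq0; apply/negPn/negP; rewrite -normr_gt0 => e0.
have [N NP] := rep_continuous_at_id v x e0.
have [g [h [[Gg gv] [Gh hv] fixN]]] := lim N.
have := NP (h \o (u \o g)) (GM _ _ Gh (GM _ _ Gu Gg)) fixN.
have Gug : G (u \o g) by exact: GM.
rewrite (rep_mul rep Gh Gug v) (rep_mul rep Gu Gg v) gv.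
by rewrite -[X in _ - X]hv -linearB (rep_norm _ Gh) ltxx.
Qed.

End VectorStabilizers.

Theorem corollary1p8 (R : realType) (d : nat) (V : discreteTopologicalType)
    (adj : rel V) (i : set V -> 'I_d) (F : {group {perm 'I_d}})
    (H : completeNormedModType R[i]) (ip : {dot H for @Num.conj R[i]})
    (pi : (V -> V) -> {linear H -> H}) (v : H) :
  (3 <= d)%N ->
  regular_tree adj d ->
  legal_coloring adj i ->
  [primitive F, on [set: 'I_d]%SET | 'P] ->
  ~~ [transitive^2 F, on [set: 'I_d]%SET | 'P] ->
  ~~ (cyclic F && prime #|F|) ->
  hilbert_product ip ->
  separable_space H ->
  ~ finite_dimensional H ->
  unitary_rep ip (universal_group_plus adj i F) pi ->
  (forall w : H,
     (forall g, universal_group_plus adj i F g -> pi g w = w) -> w = 0) ->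
  v != 0 ->
  ~ compact (vector_stab (universal_group_plus adj i F) pi v
             : set {compact-open, V -> V}) ->
  exists2 eta, ends adj eta &
    vector_stab (universal_group_plus adj i F) pi v
    = end_stab0 (universal_group_plus adj i F) eta.
Proof.
move=> _ tr legal prim _ ncyc hil _ _ rep noinv v0 ncpt.
have Ggrp := plus_subgroup adj i F.
set K := vector_stab _ pi v in ncpt *.
have KG : K `<=` universal_group_plus adj i F by move=> g [].
have Kgrp : subgroup_Aut adj K := vector_stab_subgroup Ggrp rep v.
have limit x u := vector_stab_limit hil Ggrp rep (v := v) (x := x) (u := u).
have [] := mautner_subgroup tr legal prim ncyc Kgrp KG limit.
- by move=> GK; case/eqP: v0; apply: noinv => g /GK[].
- move=> [x Kx]; case: ncpt; apply: (vertex_fixing_compact tr (x := x)) => //.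
    by move=> g /(sub_aut Kgrp).
  move=> f lim; have Gf : universal_group_plus adj i F f.
    apply: (vertex_stab_closed tr (x := x)) => N; have [g Kg gP] := lim N.
    by exists g; split; [exact: KG|exact: Kx|].
  exact: (closed_sub Kgrp limit Gf lim).
- by [].
Qed.
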